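(* Let $k\ge 1$ and let $S$ be a $k$-dimensional simplicial complex on vertex set $[n]=\{1,\dots,n\}$ with complete $(k-1)$-skeleton, i.e. every $k$-element subset of $[n]$ is a face of $S$ (so $|F_{k-1}(S)|=\binom{n}{k}$). If $H^{k-1}(S,\mathbb{Z}/2)=0$, then $S$ is hypergraph connected.
   Context: For a simplicial complex $S$, $F_j=F_j(S)$ denotes the set of $j$-dimensional faces (faces of cardinality $j+1$). The $j$-cochains $C^j$ are the functions $f:F_j\to\mathbb{Z}/2$; the coboundary $d_j:C^j\to C^{j+1}$ is $d_jf(\sigma)=\sum_{\tau\subset\sigma,\ \dim\tau=j} f(\tau)$; $H^j(S,\mathbb{Z}/2)=\ker d_j/\operatorname{im} d_{j-1}$ (for $j\ge 1$ this agrees with reduced cohomology). A $k$-dimensional complex $S$ is called hypergraph connected if for every two $(k-1)$-faces $\alpha,\alpha'\in F_{k-1}(S)$ there is a sequence of $(k-1)$-faces $\alpha=\alpha_1,\alpha_2,\dots,\alpha_r=\alpha'$ such that $\alpha_i\cup\alpha_{i+1}\in F_k(S)$ for every $i$. *)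

(* Defs.v *)
From HB Require Import structures.
From mathcomp Require Import all_boot all_order all_algebra all_fingroup.

Set Implicit Arguments.
Unset Strict Implicit.
Unset Printing Implicit Defensive.

Import GRing.Theory.

(* Abstract simplicial complexes on the vertex set {0, ..., n-1}. The empty
   face (of dimension -1) is included whenever there is any face. *)
Structure simplicial_complex (n : nat) := SimplicialComplex {
  complex_faces :> {set {set 'I_n}};
  complex_closed : forall A B : {set 'I_n},
    A \in complex_faces -> B \subset A -> B \in complex_faces;
  complex_vertex : forall x : 'I_n, [set x] \in complex_faces
}.

(* Faces and cochains are indexed by the cardinality m of the faces, not by
   their dimension m - 1: card_faces S m is F_{m-1}(S), cochain S m is
   C^{m-1}(S, Z/2), and coboundary S m is d_{m-1} : C^{m-1} -> C^m. *)
Definition card_faces n (S : simplicial_complex n) (m : nat) : {set {set 'I_n}} :=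
  [set A in complex_faces S | #|A| == m].

Definition has_dimension n (S : simplicial_complex n) (k : nat) : Prop :=
  (exists A, A \in card_faces S k.+1) /\
  (forall A, A \in complex_faces S -> #|A| <= k.+1).

Definition face n (S : simplicial_complex n) (m : nat) : finType :=
  {A : {set 'I_n} | A \in card_faces S m}.

Definition cochain_fun n (S : simplicial_complex n) (m : nat) : Type :=
  {ffun face S m -> 'F_2}.

HB.instance Definition _ n (S : simplicial_complex n) m :=
  Finite.copy (cochain_fun S m) {ffun face S m -> 'F_2}.
HB.instance Definition _ n (S : simplicial_complex n) m :=
  GRing.Zmodule.copy (cochain_fun S m) {ffun face S m -> 'F_2}.

(* Bundled as a finZmodType, so that cochains form a finGroupType whose law is
   pointwise addition. *)
Definition cochain n (S : simplicial_complex n) (m : nat) : finZmodType :=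
  cochain_fun S m.

Definition coboundary n (S : simplicial_complex n) (m : nat)
    (f : cochain S m) : cochain S m.+1 :=
  [ffun sigma : face S m.+1 =>
     (\sum_(tau : face S m | val tau \subset val sigma)
        (f : {ffun face S m -> 'F_2}) tau)%R].

Lemma coboundaryM n (S : simplicial_complex n) m :
  {in [set: cochain S m] &, {morph @coboundary n S m : f g / (f * g)%g}}.
Proof.
move=> f g _ _; rewrite !FinRing.zmodMgE; apply/ffunP => s.
rewrite !ffunE -big_split /=.
by apply: eq_bigr => t _; rewrite ffunE.
Qed.

Canonical coboundary_morphism n (S : simplicial_complex n) m :=
  Morphism (@coboundaryM n S m).

(* H^j = ker d_j / im d_{j-1}, as a quotient of finite additive groups. For
   j = 0, C^{-1} is the space of functions on the empty face, so that this is
   reduced cohomology: unreduced H^0 never vanishes on a nonempty complex. *)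
Definition cohomology n (S : simplicial_complex n) (j : nat) :=
  ('ker (@coboundary n S j.+1) / (@coboundary n S j @* [set: cochain S j]))%g.

Definition hypergraph_connected n (S : simplicial_complex n) (k : nat) : Prop :=
  forall a b : {set 'I_n}, a \in card_faces S k -> b \in card_faces S k ->
  exists s : seq {set 'I_n},
    [/\ {subset s <= card_faces S k},
        path (fun c d => c :|: d \in card_faces S k.+1) a s
      & last a s = b].

(* Main.v *)
Require Import Defs.
From mathcomp Require Import all_boot all_order all_algebra all_fingroup.

(** Let [f] be the indicator function of a connected component of
    (k-1)-faces. The facets of a k-face lie in one component, so [f] is constant
    on them, and hence [f * z] is a cocycle for every cocycle [z], whatever the
    parity of [k]. Take for [z] the coboundary of the indicator of a (k-2)-face
    [rho]. As [f * z] is then a coboundary, and as the (k-1)-skeleton is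
    complete, [f * z] sums to zero over the facets of any set [tau] of [k+1]
    vertices, whether or not [tau] is a face. If [rho] is [tau] minus two
    vertices [p] and [q], this reads [f (tau - p) = f (tau - q)]. All k-sets are
    related by such exchanges, so there is only one component. *)

Set Implicit Arguments.
Unset Strict Implicit.
Unset Printing Implicit Defensive.

Import GRing.Theory.
Local Open Scope ring_scope.

Lemma addrr_F2 (x : 'F_2) : x + x = 0.
Proof. by rewrite -mulr2n -mulr_natr pchar_Zp // mulr0. Qed.

(** The ordered pairs (x, y) and (y, x) contribute equally and cancel in characteristic 2. This is
    the computation behind d d = 0. *)
Lemma double_sum_sym_F2 n (A : {set 'I_n}) (F : 'I_n -> 'I_n -> 'F_2) :
  (forall x y, F x y = F y x) ->
  \sum_(x in A) \sum_(y in A :\ x) F x y = 0.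
Proof.
move=> symF.
have -> : \sum_(x in A) \sum_(y in A :\ x) F x y =
    \sum_(x in A) \sum_(y in A | (x < y)%N) F x y +
    \sum_(x in A) \sum_(y in A | (y < x)%N) F x y.
  rewrite -big_split /=; apply: eq_bigr => x _.
  rewrite (bigID (fun y : 'I_n => (x < y)%N)) /=; congr (_ + _);
    apply: eq_bigl => y; rewrite !inE -val_eqE /=;
    by case: ltngtP; rewrite ?andbT ?andbF.
rewrite [X in _ + X](exchange_big_dep (mem A)) /=; last by move=> x y _ /andP[].
rewrite -[RHS](addrr_F2 (\sum_(x in A) \sum_(y in A | (x < y)%N) F x y)).
congr (_ + _); apply: eq_bigr => y yA.
by apply: eq_big => [x|x _]; rewrite ?yA.
Qed.

Lemma card_facet (T : finType) m (A : {set T}) x :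
  #|A| = m.+1 -> x \in A -> #|A :\ x| = m.
Proof. by move=> + xA; rewrite (cardsD1 x) xA => -[]. Qed.

Lemma subset_facet_ex (T : finType) m (A B : {set T}) :
  #|A| = m.+1 -> #|B| = m -> B \subset A -> exists2 x, x \in A & B = A :\ x.
Proof.
move=> cA cB sBA; have /cards1P[x defx] : #|A :\: B| == 1%N.
  by rewrite cardsD (setIidPr sBA) cA cB subSnn.
have : x \in A :\: B by rewrite defx set11.
by rewrite inE => /andP[_ xA]; exists x; rewrite // -defx setDDr setDv set0U (setIidPr sBA).
Qed.

(** Induction on the size of [A :\: B]: replace some x in [A :\: B] by some y in [B :\: A]. Both the
    old and the new set are facets of [y |: A], so [stepP] applies. *)
Lemma exchange_closed (T : finType) k (P : pred {set T}) :
  (forall (A : {set T}) x y, #|A| = k.+1 -> x \in A -> y \in A -> x != y ->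
     P (A :\ x) -> P (A :\ y)) ->
  forall A B : {set T}, #|A| = k -> #|B| = k -> P A -> P B.
Proof.
move=> stepP A B; have [d] := ubnP #|A :\: B|.
elim: d A => // d IH A leAd cA cB PA.
have cDD : #|B :\: A| = #|A :\: B| by rewrite !cardsD setIC cA cB.
have [AB0|[x xAB]] := set_0Vmem (A :\: B).
  suff -> : B = A by [].
  apply/eqP; rewrite eqEcard cA cB leqnn andbT -setD_eq0.
  by rewrite -cards_eq0 cDD AB0 cards0.
have [y yBA] : exists y, y \in B :\: A.
  by apply/card_gt0P; rewrite cDD; apply/card_gt0P; exists x.
move: (xAB) (yBA); rewrite !inE => /andP[xB xA] /andP[yA yB].
have nyx : y != x by apply: contraNneq yA => ->.
have cyA : #|y |: A| = k.+1 by rewrite cardsU1 yA cA.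
apply: (IH ((y |: A) :\ x)) => //.
- apply: leq_trans (_ : #|A :\: B| <= d)%N; last by rewrite -ltnS.
  apply: proper_card; apply/properP; split; last by exists x; rewrite // !inE eqxx /= andbF.
  apply/subsetP => z; rewrite !inE.
  by have [->|_] := eqVneq z y; [rewrite yB | case/and3P=> -> _ /= ->].
- by apply: card_facet cyA _; rewrite !inE xA orbT.
- apply: (stepP _ y x) => //; rewrite ?inE ?eqxx ?xA ?orbT //.
  by rewrite setU1K.
Qed.

Section Cochains.

Variables (n : nat) (S : simplicial_complex n).

(** Working with functions on all sets allows sums over the facets of a set that may not be a face,
    and avoids carrying membership proofs. *)
Definition cochain_of m (F : {set 'I_n} -> 'F_2) : cochain S m :=
  [ffun t : face S m => F (val t)].

Lemma cochain_ofP m (g : cochain S m) : exists F, g = cochain_of m F.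
Proof.
(* Extension by zero; the value off the faces is arbitrary. *)
exists (fun A => if insub A is Some t then (g : {ffun face S m -> 'F_2}) t else 0).
by apply/ffunP => t; rewrite ffunE valK.
Qed.

Lemma coboundary_cochain_of m F (s : face S m.+1) :
  (coboundary (cochain_of m F) : {ffun face S m.+1 -> 'F_2}) s =
  \sum_(x in val s) F (val s :\ x).
Proof.
rewrite ffunE; under eq_bigr do rewrite ffunE.
rewrite -(big_sub_cond (mem (card_faces S m)) (fun A => A \subset val s) F).
have := valP s; rewrite inE => /andP[sS /eqP cs].
have inj : {in val s &, injective (fun x => val s :\ x)}.
  move=> x y xs ys /setP/(_ x); rewrite !inE eqxx xs /= andbT.
  by move/esym/negbFE/eqP.
rewrite -(big_imset F inj) /=; apply: eq_bigl => B.
apply/andP/imsetP => [[]|[x xs ->]].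
  by rewrite inE => /andP[_ /eqP cB] sB; apply: subset_facet_ex cB sB.
by rewrite inE (complex_closed sS) ?subD1set // (card_facet cs) ?eqxx.
Qed.

Lemma trivial_cohomology_coboundary j (f : cochain S j.+1) :
  cohomology S j = 1%g -> coboundary f = 0 -> exists g : cochain S j, f = coboundary g.
Proof.
move=> H0 df0.
have : ('ker (@coboundary n S j.+1) \subset @coboundary n S j @* [set: cochain S j])%g.
  rewrite -quotient_sub1; first by rewrite [X in pred_of_set X]H0.
  by rewrite (subset_trans (subsetT _)) // sub_abelian_norm ?FinRing.zmod_abelian ?subsetT.
move/subsetP/(_ f); case/(_ _)/morphimP => [|g _ _ ->]; last by exists g.
by apply/kerP; rewrite ?inE.
Qed.

(** Both ends are required to be faces, so that a path carries the membership proofs that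
    [hypergraph_connected] asks for. *)
Definition face_adj k : rel {set 'I_n} := fun c d =>
  [&& c \in card_faces S k, d \in card_faces S k & c :|: d \in card_faces S k.+1].

Lemma face_adj_sym k : symmetric (face_adj k).
Proof. by move=> c d; rewrite /face_adj setUC andbCA. Qed.

Lemma face_adj_facets k (s : {set 'I_n}) x y :
  s \in card_faces S k.+1 -> x \in s -> y \in s -> x != y ->
  face_adj k (s :\ x) (s :\ y).
Proof.
move=> sF xs ys nxy; rewrite /face_adj -setDIr.
have -> : [set x] :&: [set y] = set0 :> {set 'I_n}.
  by apply/setP => z; rewrite !inE; case: eqVneq => // ->; apply: negbTE.
rewrite setD0 sF andbT; move: sF; rewrite !inE => /andP[sS /eqP cs].
by rewrite !(complex_closed sS) ?subD1set // !(card_facet cs) ?eqxx.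
Qed.

Lemma connect_facets k (a s : {set 'I_n}) x y :
  s \in card_faces S k.+1 -> x \in s -> y \in s ->
  connect (face_adj k) a (s :\ x) = connect (face_adj k) a (s :\ y).
Proof.
move=> sF xs ys; have [->//|nxy] := eqVneq x y.
apply: same_connect_r; first exact/sym_connect_sym/face_adj_sym.
exact/connect1/face_adj_facets.
Qed.

(** The product [f * z]: on sets [A] with one element more than [rho], the condition [rho \subset A]
    is the coboundary of the indicator of [rho]. *)
Definition component_star k (a rho A : {set 'I_n}) : 'F_2 :=
  (connect (face_adj k) a A && (rho \subset A))%:R.

(** If [rho] lies in [s], only the two facets [s :\ x] with x outside [rho] can contribute; they lie
    in the same component, so their values are equal and cancel. *)
Lemma component_star_sum m (a rho s : {set 'I_n}) :
  #|rho| = m -> s \in card_faces S m.+2 ->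
  \sum_(x in s) component_star m.+1 a rho (s :\ x) = 0.
Proof.
move=> crho sF; move: (sF); rewrite inE => /andP[_ /eqP cs].
have [x0 x0s] : exists x, x \in s by apply/card_gt0P; rewrite cs.
have [srho|nsrho] := boolP (rho \subset s); last first.
  apply: big1 => x _; rewrite /component_star subsetD1 (negbTE nsrho).
  by rewrite andbF.
have -> : \sum_(x in s) component_star m.+1 a rho (s :\ x) =
    \sum_(x in s :\: rho) (connect (face_adj m.+1) a (s :\ x0))%:R.
  rewrite [LHS](bigID (mem rho)) /= big1 ?add0r => [|x /andP[_ xr]]; last first.
    by rewrite /component_star subsetD1 xr !andbF.
  apply: eq_big => [x|x /andP[xs xr]]; first by rewrite !inE andbC.
  by rewrite /component_star subsetD1 srho xr (connect_facets _ sF xs x0s) !andbT.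
rewrite sumr_const cardsD (setIidPr srho) cs crho subSn // subSnn.
by rewrite mulr2n addrr_F2.
Qed.

Lemma component_star_cocycle m (a rho : {set 'I_n}) :
  #|rho| = m -> coboundary (cochain_of m.+1 (component_star m.+1 a rho)) = 0.
Proof.
move=> crho; apply/ffunP => s; rewrite coboundary_cochain_of [RHS]ffunE.
exact: component_star_sum crho (valP s).
Qed.

End Cochains.

Section Connectedness.

Variables (n m : nat) (S : simplicial_complex n).
Hypothesis skeleton : forall A : {set 'I_n}, #|A| = m.+1 -> A \in complex_faces S.
Hypothesis H0 : cohomology S m = 1%g.

Lemma connect_exchange (a tau : {set 'I_n}) p q :
  #|tau| = m.+2 -> p \in tau -> q \in tau -> p != q ->
  connect (face_adj S m.+1) a (tau :\ p) -> connect (face_adj S m.+1) a (tau :\ q).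
Proof.
move=> ct pt qt npq; set rho := tau :\ p :\ q.
have qtp : q \in tau :\ p by rewrite !inE eq_sym npq.
have crho : #|rho| = m by apply: card_facet (card_facet ct pt) qtp.
have [g] := trivial_cohomology_coboundary H0 (component_star_cocycle S a crho).
have [G ->] := cochain_ofP g => fE.
(* The coboundary equation is evaluated only at the facets of [tau], which are faces by [skeleton];
   [tau] itself may not be one. *)
have FE x : x \in tau ->
    component_star S m.+1 a rho (tau :\ x) = \sum_(y in tau :\ x) G (tau :\ x :\ y).
  move=> xt; have tF : tau :\ x \in card_faces S m.+1.
    by rewrite inE skeleton (card_facet ct xt) /=.
  move/ffunP/(_ (Sub (tau :\ x) tF)): fE.
  by rewrite coboundary_cochain_of ffunE !SubK.
(* Each [tau :\ x :\ y] is reached in two orders. *)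
have : \sum_(x in tau) component_star S m.+1 a rho (tau :\ x) = 0.
  rewrite (eq_bigr _ FE); apply: double_sum_sym_F2 => x y.
  by rewrite !setDDl setUC.
(* Only [tau :\ p] and [tau :\ q] contain [rho]; their two indicator values then sum to zero in
   ['F_2], so they agree. *)
rewrite (bigD1 p) //= (bigD1 q) /=; last by rewrite qt eq_sym.
rewrite big1 ?addr0 => [|x /andP[/andP[xt xp] xq]]; last first.
  by rewrite /component_star subsetD1 !inE xt xp xq !andbF.
have -> : component_star S m.+1 a rho (tau :\ p) =
    (connect (face_adj S m.+1) a (tau :\ p))%:R.
  by rewrite /component_star subD1set andbT.
have -> : component_star S m.+1 a rho (tau :\ q) =
    (connect (face_adj S m.+1) a (tau :\ q))%:R.
  by rewrite /component_star /rho setDDl setUC -setDDl subD1set andbT.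
by do 2!case: connect.
Qed.

Lemma connect_face_adj (a b : {set 'I_n}) :
  #|a| = m.+1 -> #|b| = m.+1 -> connect (face_adj S m.+1) a b.
Proof.
move=> ca cb; apply: (exchange_closed (@connect_exchange a) ca cb).
exact: connect0.
Qed.

End Connectedness.

Local Close Scope ring_scope.

Theorem theorem1p7 (n k : nat) (S : simplicial_complex n)
  (hk : 1 <= k)
  (hdim : has_dimension S k)
  (hskel : forall A : {set 'I_n}, #|A| = k -> A \in complex_faces S)
  (hH : cohomology S k.-1 = 1%g) :
  hypergraph_connected S k.
Proof.
case: k hk hdim hskel hH => // m _ _ skel H0 a b.
rewrite !inE => /andP[_ /eqP ca] /andP[_ /eqP cb].
have /connectP[s pth lst] := connect_face_adj skel H0 ca cb.
exists s; split => //; last by apply: sub_path pth => c d /and3P[].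
apply/allP; elim: s a pth {ca lst} => //= c s IH a /andP[/and3P[_ -> _]].
exact: IH.
Qed.
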